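(* Let $\boldsymbol{M}\in\mathbb{R}^{n\times n}$ be a symmetric positive semi-definite matrix of rank $r$, let $\Omega\subseteq\{1,\dots,n\}^2$ be a symmetric sampling set, and let $\eta>0$ be a step size. Set $\boldsymbol{P}_1=\boldsymbol{I}_{n^2}-\boldsymbol{P}_{\boldsymbol{U}_\perp}\otimes\boldsymbol{P}_{\boldsymbol{U}_\perp}$, $\boldsymbol{P}_2=\frac12(\boldsymbol{I}_{n^2}+\boldsymbol{T}_{n^2})$, $\boldsymbol{P}=\boldsymbol{P}_1\boldsymbol{P}_2$, and $$\boldsymbol{H}=\boldsymbol{P}\Bigl(\boldsymbol{I}_{n^2}-\eta(\boldsymbol{M}\oplus\boldsymbol{M})(\boldsymbol{S}^\top\boldsymbol{S})\Bigr)\boldsymbol{P}.$$ Let $\rho(\boldsymbol{H})$ be the spectral radius of $\boldsymbol{H}$, i.e. the largest absolute value of the eigenvalues of $\boldsymbol{H}$. If $\rho(\boldsymbol{H})<1$, then the gradient descent iteration $$\boldsymbol{X}^{k+1}=\boldsymbol{X}^k-\eta\,\mathcal{P}_\Omega\bigl(\boldsymbol{X}^k{\boldsymbol{X}^k}^\top-\boldsymbol{M}\bigr)\boldsymbol{X}^k,\qquad k=0,1,2,\dots$$ (with $\boldsymbol{X}^0\in\mathbb{R}^{n\times r}$) produces a sequence of matrices $\boldsymbol{X}^k{\boldsymbol{X}^k}^\top$ converging to $\boldsymbol{M}$ at an asymptotic linear rate $\rho(\boldsymbol{H})$; formally, there exist a neighborhood $\mathcal{N}(\boldsymbol{M})$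 of $\boldsymbol{M}$ and a numerical constant $C>0$ such that for any $\boldsymbol{X}^0\in\mathbb{R}^{n\times r}$ with $\boldsymbol{X}^0{\boldsymbol{X}^0}^\top\in\mathcal{N}(\boldsymbol{M})$ and all $k\ge 0$, $$\|\boldsymbol{X}^k{\boldsymbol{X}^k}^\top-\boldsymbol{M}\|_F\le C\,\|\boldsymbol{X}^0{\boldsymbol{X}^0}^\top-\boldsymbol{M}\|_F\,\rho(\boldsymbol{H})^k.$$
   Context: $1\le r\le n$. $\boldsymbol{M}=\boldsymbol{U}\boldsymbol{\Lambda}\boldsymbol{U}^\top$ is the rank-$r$ economy eigendecomposition of $\boldsymbol{M}$: $\boldsymbol{U}\in\mathbb{R}^{n\times r}$ has orthonormal columns and $\boldsymbol{\Lambda}$ is diagonal with the nonzero eigenvalues $\lambda_1\ge\dots\ge\lambda_r>0$. $\boldsymbol{P}_{\boldsymbol{U}_\perp}=\boldsymbol{I}_n-\boldsymbol{U}\boldsymbol{U}^\top$ is the orthogonal projection onto the null space of $\boldsymbol{M}$. $\Omega$ symmetric means $(i,j)\in\Omega\iff(j,i)\in\Omega$; $s=|\Omega|$. $\mathcal{P}_\Omega:\mathbb{R}^{n\times n}\to\mathbb{R}^{n\times n}$ is given by $[\mathcal{P}_\Omega(\boldsymbol{Z})]_{ij}=Z_{ij}$ if $(i,j)\in\Omega$ and $0$ otherwise. $\boldsymbol{S}$ is the $s\times n^2$ row selection matrix consisting of the rows of $\boldsymbol{I}_{n^2}$ indexed by $\bar\Omega=\{(i-1)n+j\mid(i,j)\in\Omega\}$.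 $\mathrm{vec}(\cdot)$ stacks the columns of a matrix on top of one another. $\boldsymbol{T}_{n^2}$ is the $n^2\times n^2$ matrix whose $(i,j)$th $n\times n$ block is $\boldsymbol{e}_j\boldsymbol{e}_i^\top$ ($1\le i,j\le n$), so that $\mathrm{vec}(\boldsymbol{E}^\top)=\boldsymbol{T}_{n^2}\mathrm{vec}(\boldsymbol{E})$ for all $\boldsymbol{E}\in\mathbb{R}^{n\times n}$. $\otimes$ is the Kronecker product and $\boldsymbol{M}\oplus\boldsymbol{M}=\boldsymbol{M}\otimes\boldsymbol{I}_n+\boldsymbol{I}_n\otimes\boldsymbol{M}$ is the Kronecker sum. $\|\cdot\|_F$ is the Frobenius norm.
   Formalization: When ρ(H)=0 the stated bound is false (n=r=1, M=1, Ω full, η=1/2: it would force exact recovery in one step), so in that case it is replaced by the bound with q^k for every q>0, the neighborhood and C depending on q; for 0<ρ(H)<1 the bound is proved as stated. *)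

(* Defs.v *)
(* MathComp with MathComp-Analysis and real-closed (complex numbers,
   Kronecker product). *)
From mathcomp Require Import all_boot all_order all_algebra.
From mathcomp Require Import all_classical all_reals all_analysis.
From mathcomp Require Import complex mxtens.

Set Implicit Arguments.
Unset Strict Implicit.
Unset Printing Implicit Defensive.

Import Order.TTheory GRing.Theory Num.Theory.
Import numFieldNormedType.Exports.

Local Open Scope classical_set_scope.
Local Open Scope ring_scope.

Definition psd (R : realType) (n : nat) (M : 'M[R]_n) : Prop :=
  forall v : 'cV[R]_n, 0 <= (v^T *m M *m v) 0 0.

(* M = U diag(lam) U^T with orthonormal columns and positive nonincreasing
   eigenvalues. *)
Definition economy_eigendecomposition (R : realType) (n r : nat)
    (M : 'M[R]_n) (U : 'M[R]_(n, r)) (lam : 'rV[R]_r) : Prop :=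
  [/\ U^T *m U = 1%:M,
      M = U *m diag_mx lam *m U^T,
      forall i j : 'I_r, (i <= j)%N -> lam 0 j <= lam 0 i
    & forall i : 'I_r, 0 < lam 0 i].

Definition proj_perp (R : realType) (n r : nat) (U : 'M[R]_(n, r)) : 'M[R]_n :=
  1%:M - U *m U^T.

Definition symmetric_set (n : nat) (Omega : {set 'I_n * 'I_n}) : Prop :=
  forall i j : 'I_n, ((i, j) \in Omega) = ((j, i) \in Omega).

Definition P_Omega (R : realType) (n : nat) (Omega : {set 'I_n * 'I_n})
    (Z : 'M[R]_n) : 'M[R]_n :=
  \matrix_(i, j) (if (i, j) \in Omega then Z i j else 0).

(* [mxtens_index (i, j)] is the position i * n + j, that is (i - 1) n + j for
   indices counted from 1. *)
Definition selection_mx (R : realType) (n : nat) (Omega : {set 'I_n * 'I_n}) :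
    'M[R]_(#|Omega|, n * n) :=
  rowsub (fun k : 'I_#|Omega| => mxtens_index (enum_val k)) 1%:M.

(* Column-stacking: entry (i, j) sits at position j * n + i.  ([mxvec] of the
   library stacks rows.) *)
Definition vec (R : realType) (n : nat) (E : 'M[R]_n) : 'cV[R]_(n * n) :=
  \col_p E (mxtens_unindex p).2 (mxtens_unindex p).1.

(* The (i, j) block, of size n x n, is e_j e_i^T. *)
Definition commutation_mx (R : realType) (n : nat) : 'M[R]_(n * n) :=
  \sum_(i < n) \sum_(j < n) (delta_mx i j *t delta_mx j i).

Lemma vec_trmx (R : realType) (n : nat) (E : 'M[R]_n) :
  vec E^T = commutation_mx R n *m vec E.
Proof.
apply/matrixP => p q; rewrite {q}ord1 !mxE.
case: (mxtens_indexP p) => a b; rewrite mxtens_indexK /=.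
rewrite (bigD1 (mxtens_index (b, a))) //= big1 ?addr0; last first.
  move=> t; case: (mxtens_indexP t) => c d neq.
  rewrite summxE big1 ?mul0r // => i _; rewrite summxE big1 // => j _.
  rewrite !mxE !mxtens_indexK /=.
  have [<-|] := eqVneq a i; last by rewrite mul0r.
  have [<-|] := eqVneq b j; last by rewrite mulr0.
  have [/= ec|] := eqVneq c b; last by rewrite mul0r.
  have [/= ed|] := eqVneq d a; last by rewrite mulr0.
  by rewrite ec ed eqxx in neq.
rewrite !mxE mxtens_indexK /= summxE (bigD1 a) //= summxE (bigD1 b) //= !mxE.
rewrite !mxtens_indexK /= !eqxx /= mulr1 !big1 ?addr0 ?mul1r //.
  by move=> i /negPf ia; rewrite summxE big1 // => j _; rewrite !mxE
    !mxtens_indexK /= eq_sym ia mul0r.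
by move=> j /negPf jb; rewrite !mxE !mxtens_indexK /= [b == j]eq_sym jb mulr0.
Qed.

Definition kronecker_sum (R : realType) (n : nat) (A B : 'M[R]_n) :
    'M[R]_(n * n) :=
  A *t 1%:M + 1%:M *t B.

Definition frobenius_norm (R : realType) (m n : nat) (A : 'M[R]_(m, n)) : R :=
  Num.sqrt (\sum_(i < m) \sum_(j < n) A i j ^+ 2).

(* The eigenvalues are the complex ones; their moduli are real elements of
   R[i], which [complex.Re] brings back to R.  For a matrix of positive size
   the set is finite and nonempty, so that [sup] is a maximum. *)
Definition spectral_radius (R : realType) (m : nat) (A : 'M[R]_m) : R :=
  sup [set complex.Re `|z| | z in
        [set z : R[i] | eigenvalue (map_mx (real_complex R) A) z]].

Section IterationMatrix.
Variables (R : realType) (n r : nat).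
Variables (M : 'M[R]_n) (U : 'M[R]_(n, r)).
Variables (Omega : {set 'I_n * 'I_n}) (eta : R).

Definition P1_mx : 'M[R]_(n * n) := 1%:M - proj_perp U *t proj_perp U.

Definition P2_mx : 'M[R]_(n * n) := 2^-1 *: (1%:M + commutation_mx R n).

Definition P_mx : 'M[R]_(n * n) := P1_mx *m P2_mx.

Definition H_mx : 'M[R]_(n * n) :=
  P_mx *m (1%:M - eta *: (kronecker_sum M M *m
                          ((selection_mx R Omega)^T *m selection_mx R Omega)))
       *m P_mx.

Definition gd_step (X : 'M[R]_(n, r)) : 'M[R]_(n, r) :=
  X - eta *: (P_Omega Omega (X *m X^T - M) *m X).

Definition gd_iter (X0 : 'M[R]_(n, r)) (k : nat) : 'M[R]_(n, r) :=
  iter k gd_step X0.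

Definition locally_converges_at_rate (q : R) : Prop :=
  exists (N : set 'M[R]_n) (C : R),
    [/\ nbhs M N, 0 < C &
      forall X0 : 'M[R]_(n, r), N (X0 *m X0^T) ->
      forall k : nat,
        frobenius_norm (gd_iter X0 k *m (gd_iter X0 k)^T - M)
          <= C * frobenius_norm (X0 *m X0^T - M) * q ^+ k].

End IterationMatrix.

(* Main.v *)
Require Import Defs.
From mathcomp Require Import all_boot all_order all_algebra.
From mathcomp Require Import all_classical all_reals all_analysis.
From mathcomp Require Import complex mxtens.
From mathcomp Require Import ring lra.

(** Write E = X X^T - M.  One gradient step maps E to L E + O(|E|^2), where
    vec (L E) = (I - eta A S^T S) vec E and A is the Kronecker sum of M with
    itself.  Since M + E has rank at most r, the block Pp E Pp, where Pp is the
    projection onto ker M, is O(|E|^2), both before and after the step; together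
    with the symmetry of E this turns the recursion into
    vec E+ = H vec E + O(|E|^2).

    The positive definite matrix B = A + Pp (x) Pp makes H B symmetric, so H is
    diagonalizable, and in the l1 norm of the coordinates in an eigenbasis H
    has operator norm at most rho(H).  No polynomial factor in k appears, and
    the scalar recursion a+ <= q a + c a^2 with 0 < q < 1 gives
    a_k <= 2 a_0 q^k for small a_0. *)

Set Implicit Arguments.
Unset Strict Implicit.
Unset Printing Implicit Defensive.

Import Order.TTheory GRing.Theory Num.Theory.
Import numFieldNormedType.Exports.

Local Open Scope classical_set_scope.
Local Open Scope ring_scope.

(** * The entrywise l1 norm of matrices *)

Definition l1norm (K : numDomainType) (m n : nat) (A : 'M[K]_(m, n)) : K :=
  \sum_i \sum_j `|A i j|.

Section L1Norm.
Variable K : numDomainType.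

Lemma l1norm_ge0 m n (A : 'M[K]_(m, n)) : 0 <= l1norm A.
Proof. by apply: sumr_ge0 => i _; apply: sumr_ge0. Qed.

Lemma l1normD m n (A B : 'M[K]_(m, n)) : l1norm (A + B) <= l1norm A + l1norm B.
Proof.
rewrite -big_split; apply: ler_sum => i _; rewrite -big_split.
by apply: ler_sum => j _; rewrite mxE ler_normD.
Qed.

Lemma l1normZ m n a (A : 'M[K]_(m, n)) : l1norm (a *: A) = `|a| * l1norm A.
Proof.
rewrite /l1norm mulr_sumr; apply: eq_bigr => i _; rewrite mulr_sumr.
by apply: eq_bigr => j _; rewrite mxE normrM.
Qed.

Lemma l1normN m n (A : 'M[K]_(m, n)) : l1norm (- A) = l1norm A.
Proof. by rewrite -scaleN1r l1normZ normrN1 mul1r. Qed.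

Lemma l1normB m n (A B : 'M[K]_(m, n)) : l1norm (A - B) <= l1norm A + l1norm B.
Proof. by rewrite -(l1normN B) l1normD. Qed.

Lemma l1norm_tr m n (A : 'M[K]_(m, n)) : l1norm A^T = l1norm A.
Proof.
rewrite /l1norm exchange_big; apply: eq_bigr => i _.
by apply: eq_bigr => j _; rewrite mxE.
Qed.

Lemma ler_entry_l1norm m n (A : 'M[K]_(m, n)) i j : `|A i j| <= l1norm A.
Proof.
rewrite /l1norm (bigD1 i) //= (bigD1 j) //= -addrA lerDl addr_ge0 ?sumr_ge0 //.
by move=> k _; apply: sumr_ge0.
Qed.

Lemma l1norm_eq0 m n (A : 'M[K]_(m, n)) : l1norm A = 0 -> A = 0.
Proof.
move=> A0; apply/matrixP => i j; rewrite mxE; apply/eqP; rewrite -normr_eq0.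
by rewrite eq_le normr_ge0 -A0 ler_entry_l1norm.
Qed.

Lemma l1normM m n p (A : 'M[K]_(m, n)) (B : 'M[K]_(n, p)) :
  l1norm (A *m B) <= l1norm A * l1norm B.
Proof.
rewrite /l1norm mulr_suml; apply: ler_sum => i _.
apply: (@le_trans _ _ (\sum_k \sum_j `|A i j| * `|B j k|)).
  apply: ler_sum => k _; rewrite mxE; apply: le_trans (ler_norm_sum _ _ _) _.
  by apply: ler_sum => j _; rewrite normrM.
rewrite exchange_big mulr_suml; apply: ler_sum => j _; rewrite -mulr_sumr.
apply: ler_wpM2l => //; rewrite [leRHS](bigD1 j) //= lerDl.
by apply: sumr_ge0 => l _; apply: sumr_ge0.
Qed.

End L1Norm.

(** * Diagonalization of a matrix made Hermitian by a Gram matrix *)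

Section SymmetrizableMatrix.
Local Open Scope sesquilinear_scope.
Variables (C : numClosedFieldType) (m k : nat).
Variables (H : 'M[C]_m) (Z : 'M[C]_(m, k)).
Hypothesis Z_free : row_free Z.
Hypothesis HZ_herm : H *m (Z *m Z^t*) = Z *m Z^t* *m H^t*.

(** In the spectral decomposition of [Z Z^*], the eigenvalue [b 0 i] is the squared length of row
    [i] of [Q Z], which is nonzero because [Q] has unit rows and [Z] independent ones. Hence
    [W = Q^-1 diag(sqrt b)] is invertible. *)
Lemma gram_factor : exists2 W : 'M[C]_m, W \in unitmx & Z *m Z^t* = W *m W^t*.
Proof.
set B := Z *m Z^t*.
have Bh : B \is hermsymmx.
  by apply/is_hermitianmxP; rewrite expr0 scale1r trmx_mul map_mxM trmxCK.
have /orthomx_spectralP := hermitian_normalmx Bh.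
have Qu := spectral_unitarymx B; have Qi := spectral_unit B.
set Q := spectralmx B in Qu Qi *; set b := spectral_diag B => BE.
have b_gt0 i : 0 < b 0 i.
  have -> : b 0 i = \sum_j `|(Q *m Z) i j| ^+ 2.
    have : diag_mx b = (Q *m Z) *m (Q *m Z)^t*.
      rewrite trmx_mul map_mxM mulmxA -(mulmxA Q) -/B BE -(invmx_unitary Qu).
      by rewrite !mulmxA mulmxV // mul1mx mulmxK.
    move=> /matrixP/(_ i i); rewrite [LHS]mxE eqxx mulr1n => ->; rewrite mxE.
    by apply: eq_bigr => j _; rewrite normCK !mxE.
  rewrite lt_def sumr_ge0 ?andbT // psumr_eq0 //; apply/negP => /allP s0.
  have : row i Q *m Z = 0 *m Z.
    rewrite mul0mx -row_mul; apply/rowP => j; rewrite !mxE.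
    by have := s0 j (mem_index_enum _); rewrite sqrf_eq0 normr_eq0 mxE => /eqP.
  move=> /(row_free_inj Z_free) r0.
  have /matrixP/(_ 0 0) : row i Q *m (row i Q)^t* = 1%:M.
    have /row_unitarymxP/(_ i i) := Qu.
    rewrite eqxx => dot; apply/matrixP => x y; rewrite !ord1 -dotmxE dot.
    by rewrite !mxE.
  by rewrite r0 mul0mx !mxE => /esym/eqP; rewrite oner_eq0.
pose s := map_mx sqrtC b.
exists (invmx Q *m diag_mx s).
  rewrite unitmx_mul unitmx_inv Qi unitmxE det_diag unitfE prodf_seq_neq0.
  by apply/allP => i _; rewrite mxE sqrtC_eq0 gt_eqF.
rewrite trmx_mul map_mxM (invmx_unitary Qu) trmxCK tr_diag_mx map_diag_mx.
rewrite mulmxA -(mulmxA _ (diag_mx s)) mulmx_diag BE (invmx_unitary Qu).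
congr (_ *m diag_mx _ *m _); apply/rowP => i; rewrite !mxE -normCK.
by rewrite ger0_norm ?sqrtC_ge0 ?ltW // sqrtCK.
Qed.

(** With [Z Z^* = W W^*], the hypothesis on [H] says that [W^-1 H W] is Hermitian, so the spectral
    theorem applies to it. *)
Lemma symmetrizable_diagonalizable :
  exists2 T : 'M[C]_m, T \in unitmx & exists d : 'rV[C]_m, T *m H = diag_mx d *m T.
Proof.
have [W Wi WE] := gram_factor.
pose K := invmx W *m H *m W.
have Kh : K \is hermsymmx.
  apply/is_hermitianmxP; rewrite expr0 scale1r; move: HZ_herm; rewrite WE => HW.
  rewrite /K !trmx_mul !map_mxM; apply: (can_inj (mulKmx Wi)).
  rewrite !mulmxA mulmxV // mul1mx.
  have Wsi : W^t* \in unitmx by rewrite map_unitmx unitmx_tr.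
  apply: (can_inj (mulmxK Wsi)); rewrite -mulmxA HW.
  by rewrite trmx_inv map_invmx mulmxKV.
have /orthomx_spectralP := hermitian_normalmx Kh.
have Si := spectral_unit K; set S := spectralmx K in Si *.
set d := spectral_diag K => KE.
exists (S *m invmx W); first by rewrite unitmx_mul unitmx_inv Si.
exists d; apply: (can_inj (mulmxK Wi)); rewrite -!mulmxA mulVmx // mulmx1.
by rewrite (mulmxA _ H) -/K KE !mulmxA mulmxV // mul1mx.
Qed.

End SymmetrizableMatrix.

(** * The spectral radius and a norm adapted to it *)

Section AdaptedNorm.
Local Open Scope sesquilinear_scope.
Variable R : realType.
Local Notation toC := (map_mx (real_complex R)).

Lemma l1norm_toC m n (A : 'M[R]_(m, n)) : l1norm (toC A) = (l1norm A)%:C%C.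
Proof.
rewrite rmorph_sum; apply: eq_bigr => i _; rewrite rmorph_sum.
by apply: eq_bigr => j _; rewrite mxE normc_def /= expr0n /= addr0 sqrtr_sqr.
Qed.

Lemma toC_conj m n (A : 'M[R]_(m, n)) : (toC A)^t* = toC A^T.
Proof.
by apply/matrixP => i j; rewrite !mxE; apply/CrealP/complex_realP; exists (A j i).
Qed.

(** This bounds the set of moduli in [spectral_radius], so that its [sup] is a genuine upper
    bound. *)
Lemma eigenvalue_norm_le (K : numFieldType) m (A : 'M[K]_m) z :
  eigenvalue A z -> `|z| <= l1norm A.
Proof.
move=> /eigenvalueP [v vA v0].
have v_gt0 : 0 < l1norm v.
  by rewrite lt_def l1norm_ge0 andbT; apply: contraNneq v0 => /l1norm_eq0 ->.
by rewrite -(ler_pM2l v_gt0) [leLHS]mulrC -l1normZ -vA l1normM.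
Qed.

Lemma le_spectral_radius m (A : 'M[R]_m) z :
  eigenvalue (toC A) z -> complex.Re `|z| <= spectral_radius A.
Proof.
move=> zA; apply: sup_upper_bound; last by exists z.
split; first by exists (complex.Re `|z|), z.
exists (l1norm A) => _ [w /eigenvalue_norm_le + <-].
by rewrite l1norm_toC lecE => /andP[].
Qed.

(* The norm is the l1 norm of the coordinates in an eigenbasis of [H]. *)
Lemma adapted_norm m k (H : 'M[R]_m) (Z : 'M[R]_(m, k)) :
  row_free Z -> H *m (Z *m Z^T) = Z *m Z^T *m H^T ->
  exists (N : 'cV[R]_m -> R) (a b : R),
    [/\ 0 < a, 0 < b, forall x y, N (x + y) <= N x + N y,
        forall x, N (H *m x) <= spectral_radius H * N x
      & forall x, N x <= b * l1norm x /\ l1norm x <= a * N x].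
Proof.
move=> Zf HZ; have [||T Ti [d Td]] := @symmetrizable_diagonalizable _ m k (toC H) (toC Z).
- by rewrite /row_free mxrank_map.
- by rewrite !toC_conj -!map_mxM HZ.
(* Norms are nonnegative elements of [R[i]], hence real, and [complex.Re] loses nothing on them. *)
have ge0_toC (w : R[i]) : 0 <= w -> w = (complex.Re w)%:C%C.
  by move=> w0; rewrite RRe_real // ger0_real.
have T0 : l1norm T = (complex.Re (l1norm T))%:C%C by apply/ge0_toC/l1norm_ge0.
have Ti0 : l1norm (invmx T) = (complex.Re (l1norm (invmx T)))%:C%C.
  by apply/ge0_toC/l1norm_ge0.
pose N (x : 'cV[R]_m) := complex.Re (l1norm (T *m toC x)).
have NE x : l1norm (T *m toC x) = (N x)%:C%C by apply/ge0_toC/l1norm_ge0.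
have N_ge0 x : 0 <= N x by rewrite -lecR -NE l1norm_ge0.
exists N, (complex.Re (l1norm (invmx T)) + 1), (complex.Re (l1norm T) + 1); split.
- by rewrite ltr_wpDl // -lecR -Ti0 l1norm_ge0.
- by rewrite ltr_wpDl // -lecR -T0 l1norm_ge0.
- move=> x y; have := l1normD (T *m toC x) (T *m toC y).
  by rewrite -mulmxDr -map_mxD !NE -rmorphD lecR.
- move=> x; rewrite -lecR rmorphM /= -!NE map_mxM mulmxA Td -mulmxA.
  rewrite /l1norm mulr_sumr; apply: ler_sum => i _; rewrite mulr_sumr.
  apply: ler_sum => j _; rewrite mul_diag_mx mxE normrM ler_wpM2r //.
  rewrite (ge0_toC `|d 0 i|) // lecR; apply: le_spectral_radius.
  (* Row [i] of [T] is a left eigenvector for [d 0 i], nonzero since [T] is invertible. *)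
  apply/eigenvalueP; exists (row i T).
    rewrite -row_mul Td; apply/rowP => l; rewrite !mxE (bigD1 i) //= mxE eqxx.
    rewrite mulr1n big1 ?addr0 // => l' /negPf l'i.
    by rewrite mxE eq_sym l'i mulr0n mul0r.
  apply: contraTneq Ti => T_i0; rewrite -row_free_unit; apply/negP => Tf.
  have /(row_free_inj Tf) : (delta_mx 0 i : 'rV_m) *m T = 0 *m T.
    by rewrite -rowE T_i0 mul0mx.
  by move=> /matrixP/(_ 0 i)/eqP; rewrite !mxE !eqxx oner_eq0.
- move=> x; split; rewrite -lecR rmorphM rmorphD /= -NE -l1norm_toC -?T0 -?Ti0.
    apply: le_trans (l1normM _ _) _; rewrite ler_wpM2r ?l1norm_ge0 //.
    by rewrite lerDl.
  rewrite -{1}(mulKmx Ti (toC x)); apply: le_trans (l1normM _ _) _.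
  by rewrite ler_wpM2r ?l1norm_ge0 // lerDl.
Qed.

End AdaptedNorm.

(** * Vectorization, the commutation matrix and the selection matrix *)

Section Vectorization.
Variables (R : realType) (n : nat).
Implicit Types E A B : 'M[R]_n.

Lemma vecD E A : vec (E + A) = vec E + vec A.
Proof. by apply/matrixP => p q; rewrite !mxE. Qed.

Lemma vecZ a E : vec (a *: E) = a *: vec E.
Proof. by apply/matrixP => p q; rewrite !mxE. Qed.

Lemma vecN E : vec (- E) = - vec E.
Proof. by rewrite -scaleN1r vecZ scaleN1r. Qed.

Lemma sum_mxtens_index (V : nmodType) m k (F : 'I_(m * k) -> V) :
  \sum_p F p = \sum_i \sum_j F (mxtens_index (i, j)).
Proof.
rewrite pair_bigA (reindex (@mxtens_index m k)) /=; last first.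
  by exists (@mxtens_unindex m k) => x _; rewrite ?mxtens_indexK ?mxtens_unindexK.
by apply: eq_bigr => -[].
Qed.

Lemma l1norm_vec E : l1norm (vec E) = l1norm E.
Proof.
rewrite /l1norm sum_mxtens_index exchange_big; apply: eq_bigr => i _.
by apply: eq_bigr => j _; rewrite big_ord1 mxE mxtens_indexK.
Qed.

Lemma tensmx_vec A B E : (A *t B) *m vec E = vec (B *m E *m A^T).
Proof.
apply/matrixP => p q; case: (mxtens_indexP p) => j i.
rewrite mxE sum_mxtens_index [RHS]mxE mxtens_indexK [RHS]mxE /=.
apply: eq_bigr => k _; rewrite !mxE mulr_suml; apply: eq_bigr => l _.
by rewrite tensmxE mxE mxtens_indexK /= -mulrA mulrC.
Qed.

Lemma vec_surj (x : 'cV[R]_(n * n)) : exists E, x = vec E.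
Proof.
exists (\matrix_(i, j) x (mxtens_index (j, i)) 0).
by apply/matrixP => p q; rewrite ord1 !mxE -surjective_pairing mxtens_unindexK.
Qed.

Lemma eq_mx_vec m (A B : 'M[R]_(m, n * n)) :
  (forall E, A *m vec E = B *m vec E) -> A = B.
Proof.
move=> AB; apply/matrixP => i j.
have [E Ej] := vec_surj (delta_mx j 0).
by have /matrixP/(_ i 0) := AB E; rewrite -Ej -!colE !mxE.
Qed.

Lemma trmx_commutation_mx : (commutation_mx R n)^T = commutation_mx R n.
Proof.
rewrite /commutation_mx linear_sum exchange_big /=; apply: eq_bigr => i _.
by rewrite linear_sum; apply: eq_bigr => j _; rewrite /= trmx_tens !trmx_delta.
Qed.

(** Both sides send [vec E] to [vec (A E^T B^T)]. *)
Lemma commutation_mx_tens A B :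
  commutation_mx R n *m (A *t B) = (B *t A) *m commutation_mx R n.
Proof.
apply: eq_mx_vec => E; rewrite -!mulmxA tensmx_vec -!vec_trmx tensmx_vec.
by rewrite !trmx_mul trmxK !mulmxA.
Qed.

Lemma selection_mx_gram (Omega : {set 'I_n * 'I_n}) (p q : 'I_(n * n)) :
  ((selection_mx R Omega)^T *m selection_mx R Omega) p q =
  ((p == q) && (mxtens_unindex p \in Omega))%:R.
Proof.
rewrite mxE; have [pO|pO] := boolP (_ \in Omega); last first.
  rewrite andbF big1 // => k _; rewrite !mxE.
  have [kp|_] := eqVneq (mxtens_index (enum_val k)) p; last by rewrite mul0r.
  by rewrite -kp mxtens_indexK enum_valP in pO.
(* Only the row of the selection matrix that picks position [p] contributes. *)
rewrite (bigD1 (enum_rank_in pO (mxtens_unindex p))) //= big1 ?addr0.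
  by rewrite !mxE enum_rankK_in // mxtens_unindexK eqxx mul1r andbT.
move=> k; apply: contraNeq => /eqP; rewrite !mxE.
have [/(canRL (@mxtens_indexK n n)) kp _|_] := eqVneq (mxtens_index (enum_val k)) p.
  by rewrite -[k](enum_valK_in pO) kp.
by rewrite mul0r.
Qed.

(** [vec] stacks columns while [selection_mx] numbers pairs row by row, so position [p] stands for
    transposed pairs on the two sides; the symmetry of [Omega] reconciles them. *)
Lemma selection_mx_vec (Omega : {set 'I_n * 'I_n}) E : symmetric_set Omega ->
  (selection_mx R Omega)^T *m selection_mx R Omega *m vec E = vec (P_Omega Omega E).
Proof.
move=> Os; apply/matrixP => p q; rewrite mxE (bigD1 p) //= big1 ?addr0.
  rewrite selection_mx_gram eqxx !mxE Os -surjective_pairing.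
  by case: (_ \in _); rewrite ?mul1r ?mul0r.
by move=> k /negPf kp; rewrite selection_mx_gram eq_sym kp mul0r.
Qed.

End Vectorization.

(** * Algebra of the iteration matrix and its symmetrizer *)

Section IterationMatrixFacts.
Variables (R : realType) (n r : nat).
Variables (M : 'M[R]_n) (U : 'M[R]_(n, r)) (lam : 'rV[R]_r).
Variables (Omega : {set 'I_n * 'I_n}) (eta : R).
Hypothesis ME : economy_eigendecomposition M U lam.

Local Notation Pp := (proj_perp U).
Local Notation Q := (Pp *t Pp).
Local Notation A := (kronecker_sum M M).
Local Notation D := ((selection_mx R Omega)^T *m selection_mx R Omega).
Local Notation P1 := (P1_mx U).
Local Notation P2 := (P2_mx R n).
Local Notation P := (P_mx U).

Lemma trmx_proj_perp : Pp^T = Pp.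
Proof. by rewrite linearB /= trmx1 trmx_mul trmxK. Qed.

Lemma proj_perp_U : Pp *m U = 0.
Proof.
by case: ME => UU _ _ _; rewrite mulmxBl mul1mx -mulmxA UU mulmx1 subrr.
Qed.

Lemma proj_perp_idem : Pp *m Pp = Pp.
Proof. by rewrite {2}/proj_perp mulmxBr mulmx1 mulmxA proj_perp_U mul0mx subr0. Qed.

Lemma trmx_economy : M^T = M.
Proof.
by case: ME => _ -> _ _; rewrite !trmx_mul trmxK tr_diag_mx mulmxA.
Qed.

Lemma proj_perp_M : Pp *m M = 0.
Proof. by case: ME => _ -> _ _; rewrite !mulmxA proj_perp_U !mul0mx. Qed.

Lemma M_proj_perp : M *m Pp = 0.
Proof.
apply: trmx_inj.
by rewrite trmx_mul trmx_economy trmx_proj_perp proj_perp_M trmx0.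
Qed.

Lemma kronecker_sum_vec (E : 'M[R]_n) : A *m vec E = vec (E *m M + M *m E).
Proof.
by rewrite mulmxDl !tensmx_vec mul1mx trmx_economy trmx1 mulmx1 -vecD.
Qed.

Lemma trmx_kronecker_sum : A^T = A.
Proof. by rewrite linearD /= !trmx_tens trmx_economy trmx1. Qed.

Lemma trmx_tens_proj_perp : Q^T = Q.
Proof. by rewrite trmx_tens trmx_proj_perp. Qed.

Lemma kronecker_sum_tens_proj_perp : A *m Q = 0.
Proof. by rewrite mulmxDl !tensmx_mul !mul1mx M_proj_perp tens0mx tensmx0 addr0. Qed.

Lemma tens_proj_perp_kronecker_sum : Q *m A = 0.
Proof.
by apply: trmx_inj; rewrite trmx_mul trmx_tens_proj_perp trmx_kronecker_sum
  kronecker_sum_tens_proj_perp trmx0.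
Qed.

Lemma trmx_P2_mx : P2^T = P2.
Proof. by rewrite linearZ linearD /= trmx1 trmx_commutation_mx. Qed.

Lemma P2_tens_proj_perp : P2 *m Q = Q *m P2.
Proof.
by rewrite -scalemxAl -scalemxAr mulmxDl mulmxDr mulmx1 mul1mx commutation_mx_tens.
Qed.

Lemma P2_kronecker_sum : P2 *m A = A *m P2.
Proof.
rewrite -scalemxAl -scalemxAr mulmxDl [in RHS]mulmxDr mulmx1 mul1mx.
by rewrite mulmxDl mulmxDr !commutation_mx_tens [_ + _ *m commutation_mx R n]addrC.
Qed.

(** Both factors of [P] are symmetric, and they commute. *)
Lemma trmx_P_mx : P^T = P.
Proof.
rewrite trmx_mul trmx_P2_mx linearB /= trmx1 trmx_tens_proj_perp /P_mx /P1_mx.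
by rewrite mulmxBr mulmxBl mulmx1 mul1mx P2_tens_proj_perp.
Qed.

Lemma P_tens_proj_perp : P *m Q = 0.
Proof.
rewrite -mulmxA P2_tens_proj_perp mulmxA mulmxBl mul1mx tensmx_mul proj_perp_idem subrr.
by rewrite mul0mx.
Qed.

Lemma P_kronecker_sum : P *m A = A *m P.
Proof.
rewrite -mulmxA P2_kronecker_sum !mulmxA; congr (_ *m _).
rewrite mulmxBl mulmxBr mul1mx mulmx1.
by rewrite kronecker_sum_tens_proj_perp tens_proj_perp_kronecker_sum.
Qed.

(** Since [P Q = 0] and [P] commutes with [A], the product [H (A + Q)] equals
    [P A P - eta A (P D P) A], which is visibly symmetric. The summand [Q] changes nothing here; it
    makes the symmetrizer definite on the kernel of [A]. *)
Lemma H_mx_symmetrizable :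
  H_mx M U Omega eta *m (A + Q) = (A + Q) *m (H_mx M U Omega eta)^T.
Proof.
suff HAs : (H_mx M U Omega eta *m (A + Q))^T = H_mx M U Omega eta *m (A + Q).
  by rewrite -HAs trmx_mul [(A + Q)^T]linearD /= trmx_kronecker_sum trmx_tens_proj_perp.
have -> : H_mx M U Omega eta *m (A + Q) = P *m A *m P - eta *: (A *m (P *m D *m P) *m A).
  rewrite /H_mx -mulmxA [P *m (A + Q)]mulmxDr P_tens_proj_perp addr0.
  rewrite mulmxBr mulmx1 -scalemxAr mulmxBl -scalemxAl [P *m (A *m D)]mulmxA.
  congr (_ - _ *: _); first by rewrite -[RHS]mulmxA P_kronecker_sum.
  by rewrite {1}P_kronecker_sum !mulmxA.
rewrite linearB linearZ /=; have := trmx_P_mx; move: (P_mx U) => p pT.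
by rewrite !trmx_mul !trmxK pT trmx_kronecker_sum !mulmxA.
Qed.

(** With [M = Y Y^T] and [Q = Q Q^T], the blocks [Y (x) I], [I (x) Y] and [Q] side by side form [Z].
    Its rows are independent, which encodes positive definiteness of [A + Q]. *)
Lemma kronecker_sum_gram : exists (k : nat) (Z : 'M[R]_(n * n, k)),
  row_free Z /\ A + Q = Z *m Z^T.
Proof.
case: (ME) => UU ME' _ lam_gt0.
pose s : 'rV[R]_r := map_mx Num.sqrt lam.
pose Y := U *m diag_mx s; pose Y' := diag_mx (map_mx GRing.inv s) *m U^T.
have YY : Y *m Y^T = M.
  rewrite trmx_mul tr_diag_mx mulmxA -(mulmxA U) mulmx_diag ME'.
  congr (_ *m diag_mx _ *m _); apply/rowP => i; rewrite !mxE -expr2 sqr_sqrtr //.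
  exact: ltW.
have YY' : Y *m Y' = U *m U^T.
  rewrite mulmxA -(mulmxA U) mulmx_diag; congr (_ *m _).
  rewrite -[RHS]mulmx1; congr (_ *m _); rewrite -diag_const_mx; congr diag_mx.
  by apply/rowP => i; rewrite !mxE divff // gt_eqF // sqrtr_gt0.
exists (r * n + (n * r + n * n))%N.
exists (row_mx (Y *t 1%:M) (row_mx (1%:M *t Y) Q)); split.
  apply/row_freeP.
  (* A right inverse of [Z]: the three block products are [U U^T (x) I], [Pp (x) U U^T] and
     [Pp (x) Pp], and they sum to the identity. *)
  exists (col_mx (Y' *t 1%:M) (col_mx ((1%:M *t Y') *m (Pp *t 1%:M)) 1%:M)).
  rewrite !mul_row_col mulmx1 mulmxA !tensmx_mul !mul1mx mulmx1 YY'.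
  have tensDl (X X' W : 'M[R]_n) : X *t W + X' *t W = (X + X') *t W.
    by apply/matrixP => i j; rewrite !mxE mulrDl.
  have tensDr (X W W' : 'M[R]_n) : X *t W + X *t W' = X *t (W + W').
    by apply/matrixP => i j; rewrite !mxE mulrDr.
  have tens11 : @tensmx R n n n n 1%:M 1%:M = 1%:M.
    apply/matrixP => i j; case: (mxtens_indexP i) => a b.
    case: (mxtens_indexP j) => c d; rewrite tensmxE !mxE.
    by rewrite (can_eq (@mxtens_indexK n n)) xpair_eqE -natrM mulnb.
  by rewrite tensDr subrKC tensDl subrKC tens11.
rewrite !tr_row_mx !mul_row_col !trmx_tens trmx1 !tensmx_mul mulmx1 YY.
by rewrite trmx_proj_perp proj_perp_idem addrA.
Qed.

End IterationMatrixFacts.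

(** * Comparison of the l1 and Frobenius norms; l1 balls as neighborhoods *)

Section NormComparison.
Variable R : realType.

Lemma frobenius_norm_le_l1norm m n (A : 'M[R]_(m, n)) :
  frobenius_norm A <= l1norm A.
Proof.
rewrite -[leRHS]ger0_norm ?l1norm_ge0 // -sqrtr_sqr; apply: ler_wsqrtr.
rewrite expr2 /l1norm mulr_suml; apply: ler_sum => i _; rewrite mulr_suml.
apply: ler_sum => j _; rewrite -real_normK ?num_real // expr2 ler_wpM2l //.
exact: ler_entry_l1norm.
Qed.

Lemma l1norm_le_frobenius_norm m n (A : 'M[R]_(m, n)) :
  l1norm A <= (m * n)%:R * frobenius_norm A.
Proof.
suff entry_le i j : `|A i j| <= frobenius_norm A.
  apply: (@le_trans _ _ (\sum_(i < m) \sum_(j < n) frobenius_norm A)).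
    by apply: ler_sum => i _; apply: ler_sum.
  by rewrite !sumr_const !card_ord -mulrnA mulnC mulr_natl.
rewrite -sqrtr_sqr; apply: ler_wsqrtr; rewrite (bigD1 i) //= (bigD1 j) //=.
rewrite -addrA lerDl addr_ge0 ?sumr_ge0 // => k _; rewrite ?sqr_ge0 //.
by apply: sumr_ge0 => l _; rewrite sqr_ge0.
Qed.

Lemma nbhs_l1norm_ball m n (A : 'M[R]_(m, n)) e :
  0 < e -> nbhs A [set B | l1norm (B - A) <= e].
Proof.
(* The successor avoids a division by zero for an empty matrix. *)
move=> e0; have mn0 : 0 < (m * n).+1%:R :> R by rewrite ltr0n.
apply/nbhs_ballP; exists (e / (m * n).+1%:R); first exact: divr_gt0.
move=> B [_ AB] /=.
apply: (@le_trans _ _ (\sum_(i < m) \sum_(j < n) (e / (m * n).+1%:R))).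
  apply: ler_sum => i _; apply: ler_sum => j _.
  by rewrite !mxE distrC ltW //; have := AB i j.
rewrite !sumr_const !card_ord -mulrnA mulnC -[leLHS]mulr_natr mulrAC ler_pdivrMr //.
by rewrite ler_pM2l // ler_nat.
Qed.

End NormComparison.

(** * The scalar recursion with a quadratic perturbation *)

(* With [kappa = c / (q (1 - q))], the quantity [a k / (1 - kappa * a k)]
   contracts by the exact factor [q]; the invariant is the resulting bound,
   cleared of denominators. *)
Lemma quadratic_perturbation_decay (R : realType) (q c e0 : R) :
  0 < q < 1 -> 0 < c -> 0 < e0 ->
  exists2 e, 0 < e & forall a : nat -> R, (forall k, 0 <= a k) -> a 0%N <= e ->
    (forall k, a k <= e0 -> a k.+1 <= q * a k + c * a k ^+ 2) ->
    forall k, a k <= 2 * a 0%N * q ^+ k.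
Proof.
move=> /andP[q0 q1] c0 e00.
have q1' : 0 < 1 - q by rewrite subr_gt0.
have [kappa kappa0 kappaE] : exists2 kappa : R, 0 < kappa & kappa * q * (1 - q) = c.
  exists (c / (q * (1 - q))); first by rewrite divr_gt0 ?mulr_gt0.
  by rewrite -mulrA mulfVK // gt_eqF // mulr_gt0.
(* [kappa * e <= 1/2] gives [1 / (1 - kappa * a 0) <= 2], the source of the factor 2 in the
   conclusion. *)
have [e [e_gt0 e_le e_le0]] : exists e : R, [/\ 0 < e, kappa * e <= 2^-1 & e <= e0].
  exists (Num.min e0 (2 * kappa)^-1); split; last by rewrite ge_min lexx.
    by rewrite lt_min e00 invr_gt0 mulr_gt0.
  have -> : 2^-1 = kappa * (2 * kappa)^-1.
    by rewrite invfM mulrCA divff ?mulr1 // gt_eqF.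
  by rewrite ler_pM2l // ge_min lexx orbT.
exists e => // a a_ge0 a0e step.
have a0k : kappa * a 0%N <= 2^-1.
  by apply: le_trans e_le; rewrite ler_pM2l.
suff inv k : a k <= e /\
    a k * (1 - kappa * a 0%N) <= q ^+ k * a 0%N * (1 - kappa * a k).
  move=> k; have [_ ak] := inv k.
  have : a k * (1 - kappa * a 0%N) <= q ^+ k * a 0%N.
    apply: le_trans ak _; rewrite ler_piMr ?mulr_ge0 ?exprn_ge0 ?(ltW q0) //.
    by rewrite gerBl mulr_ge0 // ltW.
  have : a k * 2^-1 <= a k * (1 - kappa * a 0%N) by rewrite ler_wpM2l //; lra.
  lra.
elim: k => [|k [ake IH]]; first by rewrite expr0 mul1r.
have := step k; have := a_ge0 k; have := a_ge0 k.+1.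
set x := a k in ake IH *; set y := a k.+1 => y_ge0 x_ge0 /(_ _) y_le.
have {y_le} : y <= q * x + c * x ^+ 2.
  by apply: y_le; apply: le_trans ake _.
set y' := _ + _ => y_le.
have kx : kappa * x <= 2^-1 by apply: le_trans e_le; rewrite ler_pM2l.
(* This gives [y' = (q + c x) x <= x], so the sequence never leaves [[0, e]]. *)
have cx : c * x <= 1 - q.
  rewrite -kappaE mulrAC -[leRHS]mul1r ler_wpM2r ?(ltW q1') // mulrAC.
  have : kappa * x * q <= 2^-1 * 1 
    by apply: ler_pM; rewrite ?mulr_ge0 ?(ltW q0) ?(ltW q1) ?(ltW kappa0).
  lra.
have y'x : y' <= x.
  have : c * x * x <= (1 - q) * x by rewrite ler_wpM2r.
  rewrite /y'; lra.
split; first exact: le_trans y_le (le_trans y'x ake).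
set t := q ^+ k * a 0%N in IH.
have t_ge0 : 0 <= t by rewrite mulr_ge0 // exprn_ge0 // ltW.
have -> : q ^+ k.+1 * a 0%N = t * q by rewrite exprSr mulrAC.
clearbody t.
have key : y' * (1 - kappa * a 0%N) <= t * q * (1 - kappa * y').
  apply: (@le_trans _ _ ((q + c * x) * (t * (1 - kappa * x)))).
    have -> : y' * (1 - kappa * a 0%N) = (q + c * x) * (x * (1 - kappa * a 0%N)).
      by rewrite /y'; ring.
    by rewrite ler_wpM2l // addr_ge0 ?mulr_ge0 ?(ltW q0) ?(ltW c0).
  rewrite -subr_ge0.
  (* The choice of [kappa] cancels the term linear in [x]; the remaining one is nonnegative. *)
  have -> : t * q * (1 - kappa * y') - (q + c * x) * (t * (1 - kappa * x)) =
      t * (x * (kappa * q * (1 - q) - c) + kappa * c * x ^+ 2 * (1 - q)).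
    by rewrite /y'; ring.
  rewrite kappaE subrr mulr0 add0r.
  by rewrite !mulr_ge0 ?exprn_ge0 ?(ltW kappa0) ?(ltW c0) ?(ltW q1').
(* Gathered on one side, the invariant has a nonnegative coefficient on [y'], so it passes to the
   smaller [y]. *)
have : (y' - y) * (1 - kappa * a 0%N + t * q * kappa) >= 0.
  rewrite mulr_ge0 ?subr_ge0 // addr_ge0 ?mulr_ge0 ?(ltW q0) ?(ltW kappa0) //.
  lra.
lra.
Qed.

(** * Linearization of the gradient step and local convergence *)

Section Dynamics.
Variables (R : realType) (n r : nat).
Variables (M : 'M[R]_n) (U : 'M[R]_(n, r)) (lam : 'rV[R]_r).
Variables (Omega : {set 'I_n * 'I_n}) (eta : R).
Hypothesis ME : economy_eigendecomposition M U lam.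
Hypothesis Omega_sym : symmetric_set Omega.
Hypothesis eta_gt0 : 0 < eta.

Local Notation Pp := (proj_perp U).
Local Notation A := (kronecker_sum M M).
Local Notation D := ((selection_mx R Omega)^T *m selection_mx R Omega).
Local Notation P := (P_mx U).

(** For small [E], the map [V -> V E L'] at least halves the norm. A kernel [V] satisfies
    [V = - V E L'], hence vanishes; the inverse satisfies [K = L' - K E L'], hence has norm at most
    twice that of [L']. *)
Lemma perturbed_inverse_bound : exists K0 d : R, [/\ 0 < K0, 0 < d &
  forall E : 'M[R]_r, l1norm E <= d ->
    diag_mx lam + E \in unitmx /\ l1norm (invmx (diag_mx lam + E)) <= K0].
Proof.
case: ME => _ _ _ lam_gt0.
pose L' := diag_mx (map_mx GRing.inv lam).
have LL' : diag_mx lam *m L' = 1%:M.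
  rewrite mulmx_diag -diag_const_mx; congr diag_mx.
  by apply/rowP => i; rewrite !mxE divff // gt_eqF.
pose l := l1norm L' + 1; have l_gt0 : 0 < l by rewrite ltr_wpDl ?l1norm_ge0.
have L'l : l1norm L' <= l by rewrite lerDl.
exists (2 * l), (2 * l)^-1; split; rewrite ?invr_gt0 ?mulr_gt0 // => E Ed.
have half m (V : 'M[R]_(m, r)) : l1norm (V *m E *m L') <= 2^-1 * l1norm V.
  apply: le_trans (l1normM _ _) _.
  apply: (@le_trans _ _ (l1norm V * (2 * l)^-1 * l)).
    apply: ler_pM; rewrite ?l1norm_ge0 //; apply: le_trans (l1normM _ _) _.
    by rewrite ler_wpM2l ?l1norm_ge0.
  by rewrite invfM mulrA -mulrA mulVf ?gt_eqF // mulr1 mulrC.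
set N := diag_mx lam + E.
have Nu : N \in unitmx.
  rewrite -row_free_unit -kermx_eq0; apply/eqP/l1norm_eq0.
  have := mulmx_ker N; move: (kermx N) => V /(congr1 (mulmx^~ L')).
  rewrite mul0mx mulmxDr mulmxDl -(mulmxA _ (diag_mx lam)) LL' mulmx1 => /eqP.
  rewrite addr_eq0 => /eqP VE; have := half _ V; have := l1norm_ge0 V.
  by rewrite -[l1norm (V *m E *m L')]l1normN -VE; lra.
split=> //; set K := invmx N.
have KE : K = L' - K *m E *m L'.
  have := mulVmx Nu; rewrite -/K => /(congr1 (mulmx^~ L')).
  rewrite mul1mx mulmxDr mulmxDl -(mulmxA _ (diag_mx lam)) LL' mulmx1.
  by move=> /(canRL (addrK _)).
have := l1normB L' (K *m E *m L'); rewrite -KE; have := half _ K; lra.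
Qed.

(* With [A = U^T X] and [V = Pp X], [U^T E Pp = A V^T] is [O(E)] and
   [A A^T = diag lam + U^T E U] is boundedly invertible, so
   [Pp E Pp = V V^T = (A V^T)^T (A A^T)^-1 (A V^T)] is [O(E^2)]. *)
Lemma proj_perp_residual_bound : exists c d : R, [/\ 0 < c, 0 < d &
  forall X : 'M[R]_(n, r), let E := X *m X^T - M in
    l1norm E <= d -> l1norm (Pp *m E *m Pp) <= c * l1norm E ^+ 2].
Proof.
have [K0 [d [K0_gt0 d_gt0 Kd]]] := perturbed_inverse_bound.
have [UU ME' _ _] := ME.
pose u := l1norm U + 1; have u_gt0 : 0 < u by rewrite ltr_wpDl ?l1norm_ge0.
have Uu : l1norm U <= u by rewrite lerDl.
pose p := l1norm Pp + 1; have p_gt0 : 0 < p by rewrite ltr_wpDl ?l1norm_ge0.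
have Ppp : l1norm Pp <= p by rewrite lerDl.
exists (K0 * (u * p) ^+ 2), (d / u ^+ 2).
split; rewrite ?mulr_gt0 ?exprn_gt0 ?invr_gt0 ?exprn_gt0 ?mulr_gt0 // => X E Ed.
have XE : X *m X^T = M + E by rewrite addrC subrK.
clearbody E; have [|Nu NK0] := Kd (U^T *m E *m U).
  apply: le_trans (l1normM _ _) _.
  apply: (@le_trans _ _ (u * (d / u ^+ 2) * u)).
    apply: ler_pM; rewrite ?l1norm_ge0 //; apply: le_trans (l1normM _ _) _.
    by apply: ler_pM; rewrite ?l1norm_ge0 ?l1norm_tr.
  by rewrite mulrAC mulrC -mulrA -expr2 mulVf ?mulr1 // expf_neq0 // gt_eqF.
have NE : diag_mx lam + U^T *m E *m U = (U^T *m X) *m (U^T *m X)^T.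
  rewrite trmx_mul trmxK mulmxA -(mulmxA U^T X).
  rewrite XE (mulmxDr _ M) (mulmxDl (_ *m M)); congr (_ + _).
  by rewrite {1}ME' !mulmxA UU mul1mx -mulmxA UU mulmx1.
have AV : U^T *m E *m Pp = (U^T *m X) *m (Pp *m X)^T.
  rewrite trmx_mul trmx_proj_perp mulmxA -(mulmxA U^T X).
  rewrite XE (mulmxDr _ M) (mulmxDl (_ *m M)).
  by rewrite -(mulmxA _ M) (M_proj_perp ME) mulmx0 add0r.
have -> : Pp *m E *m Pp = (U^T *m E *m Pp)^T *m
    invmx (diag_mx lam + U^T *m E *m U) *m (U^T *m E *m Pp).
  rewrite NE in Nu; move: (Nu); rewrite unitmx_mul unitmx_tr andbb => Au.
  rewrite NE AV; set a := U^T *m X in Nu Au *; set v := Pp *m X.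
  have -> : Pp *m E *m Pp = v *m v^T.
    rewrite trmx_mul trmx_proj_perp mulmxA -(mulmxA Pp X).
    rewrite XE (mulmxDr _ M) (mulmxDl (_ *m M)).
    by rewrite (proj_perp_M ME) mul0mx add0r.
  (* [a] is square because [X] has exactly [r] columns: this is where the rank bound on [X X^T]
     enters. *)
  have aa : a^T *m invmx (a *m a^T) *m a = 1%:M.
    apply: (can_inj (mulKmx Au)); rewrite mulmx1 !mulmxA.
    by rewrite mulmxV // mul1mx.
  clearbody a v; rewrite trmx_mul trmxK -(mulmxA v) -mulmxA.
  by rewrite (mulmxA (_ *m _) a) aa mul1mx.
apply: le_trans (l1normM _ _) _.
have bound : l1norm (U^T *m E *m Pp) <= u * p * l1norm E.
  apply: le_trans (l1normM _ _) _; rewrite mulrAC.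
  apply: ler_pM; rewrite ?l1norm_ge0 //; apply: le_trans (l1normM _ _) _.
  by rewrite l1norm_tr ler_wpM2r ?l1norm_ge0.
have -> : K0 * (u * p) ^+ 2 * l1norm E ^+ 2 =
  u * p * l1norm E * K0 * (u * p * l1norm E) by ring.
apply: ler_pM; rewrite ?l1norm_ge0 //; apply: le_trans (l1normM _ _) _.
by apply: ler_pM; rewrite ?l1norm_ge0 // l1norm_tr.
Qed.

Lemma trmx_P_Omega (E : 'M[R]_n) : E^T = E -> (P_Omega Omega E)^T = P_Omega Omega E.
Proof.
by move=> ET; apply/matrixP => i j; rewrite !mxE -Omega_sym -{1}ET mxE.
Qed.

Lemma l1norm_P_Omega (E : 'M[R]_n) : l1norm (P_Omega Omega E) <= l1norm E.
Proof.
apply: ler_sum => i _; apply: ler_sum => j _; rewrite mxE.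
by case: ifP; rewrite ?normr0.
Qed.

(** As [G] is linear in [E], these are the terms of order two and three of the new residual. *)
Definition gd_remainder (E : 'M[R]_n) : 'M[R]_n :=
  let G := P_Omega Omega E in
  eta ^+ 2 *: (G *m (M + E) *m G) - eta *: (G *m E + E *m G).

(** The step is [Y = (I - eta G) X] with [G] symmetric, so
    [Y Y^T = (I - eta G) (M + E) (I - eta G)]. *)
Lemma gd_residual (X : 'M[R]_(n, r)) :
  let E := X *m X^T - M in let G := P_Omega Omega E in
  let Y := gd_step M Omega eta X in
  Y *m Y^T - M = E - eta *: (G *m M + M *m G) + gd_remainder E.
Proof.
move=> E G Y.
have XE : X *m X^T = M + E by rewrite addrC subrK.
have ET : E^T = E by rewrite linearB /= trmx_mul trmxK (trmx_economy ME).
have GT : G^T = G by exact: trmx_P_Omega.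
have -> : Y *m Y^T = X *m X^T - eta *: (G *m (X *m X^T) + (X *m X^T) *m G)
    + eta ^+ 2 *: (G *m (X *m X^T) *m G).
  rewrite /Y /gd_step -/E -/G [(X - _)^T]linearB /= [(eta *: _)^T]linearZ /=.
  rewrite trmx_mul GT mulmxBl !mulmxBr.
  rewrite -!scalemxAl -!scalemxAr scalerA -expr2 !mulmxA scalerDr.
  by rewrite opprB opprD -!addrA; congr (_ + _); rewrite [RHS]addrC -addrA.
rewrite XE /gd_remainder -/G; clearbody G; clear Y ET; clearbody E.
rewrite [G *m (M + E)]mulmxDr [(M + E) *m G]mulmxDl.
apply/matrixP => i j; rewrite !mxE; ring.
Qed.

(** On symmetric matrices [P] only removes the block [Pp E Pp]. Inserting [P] before and after the
    linear part therefore costs one such block each time, and both are quadratically small by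
    [proj_perp_residual_bound]. *)
Lemma gd_step_linearization : exists c d : R, [/\ 0 < c, 0 < d &
  forall X : 'M[R]_(n, r), let E := X *m X^T - M in
    let Y := gd_step M Omega eta X in l1norm E <= d ->
    l1norm (vec (Y *m Y^T - M) - H_mx M U Omega eta *m vec E)
      <= c * l1norm E ^+ 2].
Proof.
have [c0 [d0 [c0_gt0 d0_gt0 perp]]] := proj_perp_residual_bound.
pose m := l1norm M; have m_ge0 : 0 <= m := l1norm_ge0 M.
(* [c2] bounds the remainder by [c2 e^2]; [c3] bounds the new residual by [c3 e]. *)
pose c2 := 2 * eta + eta ^+ 2 * (m + 1).
have c2_gt0 : 0 < c2.
  by rewrite ltr_wpDr ?mulr_ge0 ?exprn_ge0 ?(ltW eta_gt0) ?addr_ge0 ?mulr_gt0.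
pose c3 := 1 + 2 * eta * m + c2.
have c3_ge1 : 1 <= c3.
  by rewrite /c3 -addrA lerDl addr_ge0 ?(ltW c2_gt0) ?mulr_ge0 ?(ltW eta_gt0).
have c3_gt0 : 0 < c3 := lt_le_trans ltr01 c3_ge1.
pose L : 'M[R]_(n * n) := 1%:M - eta *: (A *m D).
pose c := l1norm (P *m L) * c0 + l1norm P * c2 + c0 * c3 ^+ 2.
(* The bound 1 gives [e^2 <= e]; the bound [d0 / c3] keeps the residuals before and after the step
   below [d0]. *)
exists c, (Num.min 1 (d0 / c3)); split.
- by rewrite ltr_wpDl ?addr_ge0 ?mulr_ge0 ?l1norm_ge0 ?(ltW c0_gt0) ?(ltW c2_gt0)
    ?mulr_gt0 ?exprn_gt0.
- by rewrite lt_min ltr01 divr_gt0.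
move=> X E Y; rewrite le_min => /andP[e_le1].
rewrite ler_pdivlMr // => e_led.
have e_ge0 := l1norm_ge0 E; set e := l1norm E in e_le1 e_led e_ge0 *.
pose F := Y *m Y^T - M; rewrite -/F.
have FE := gd_residual X; rewrite /= -/E -/Y -/F in FE.
set G := P_Omega Omega E in FE.
have Ge : l1norm G <= e by exact: l1norm_P_Omega.
have MEe : l1norm (M + E) <= m + 1.
  by apply: le_trans (l1normD _ _) _; rewrite lerD2l.
have rem : l1norm (gd_remainder E) <= c2 * e ^+ 2.
  apply: le_trans (l1normB _ _) _; rewrite !l1normZ -/G.
  rewrite (ger0_norm (ltW eta_gt0)) ger0_norm ?exprn_ge0 ?(ltW eta_gt0) //.
  rewrite /c2 mulrDl addrC lerD //.
    rewrite (mulrC 2) -mulrA ler_wpM2l ?(ltW eta_gt0) //.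
    apply: le_trans (l1normD _ _) _; rewrite mulr_natl mulr2n expr2 lerD //.
      by apply: le_trans (l1normM _ _) _; rewrite ler_wpM2r.
    by apply: le_trans (l1normM _ _) _; rewrite ler_wpM2l.
  rewrite -mulrA ler_wpM2l ?exprn_ge0 ?(ltW eta_gt0) //.
  apply: le_trans (l1normM _ _) _; rewrite expr2 mulrA.
  apply: ler_pM; rewrite ?l1norm_ge0 //.
  by apply: le_trans (l1normM _ _) _; rewrite mulrC ler_pM ?l1norm_ge0.
have e2_le : e ^+ 2 <= e by rewrite expr2 ler_piMl.
have Fe : l1norm F <= c3 * e.
  rewrite FE; apply: le_trans (l1normD _ _) _.
  apply: (@le_trans _ _ (e + 2 * eta * m * e + c2 * e)); last by rewrite /c3; lra.
  apply: lerD; last by apply: le_trans rem _; rewrite ler_wpM2l ?(ltW c2_gt0).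
  apply: le_trans (l1normB _ _) _; rewrite lerD2l l1normZ.
  rewrite (ger0_norm (ltW eta_gt0)) (mulrC 2) -!mulrA ler_wpM2l ?(ltW eta_gt0) //.
  apply: le_trans (l1normD _ _) _; rewrite mulr_natl mulr2n lerD //.
    by apply: le_trans (l1normM _ _) _; rewrite mulrC ler_wpM2l.
  by apply: le_trans (l1normM _ _) _; rewrite ler_wpM2l.
have F_perp : l1norm (Pp *m F *m Pp) <= c0 * c3 ^+ 2 * e ^+ 2.
  apply: (@le_trans _ _ (c0 * l1norm F ^+ 2)).
    by apply: (perp Y); rewrite -/F; apply: le_trans Fe _; rewrite mulrC.
  by rewrite -mulrA ler_wpM2l ?(ltW c0_gt0) // -exprMn lerXn2r ?nnegrE ?l1norm_ge0
    ?mulr_ge0 ?(ltW c3_gt0).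
have E_perp : l1norm (Pp *m E *m Pp) <= c0 * e ^+ 2.
  by apply: (perp X); rewrite -/E -/e; apply: le_trans e_led; rewrite ler_peMr.
have P_vec (B : 'M[R]_n) : B^T = B -> P *m vec B = vec B - vec (Pp *m B *m Pp).
  move=> BT; rewrite /P_mx -mulmxA /P2_mx -scalemxAl mulmxDl mul1mx -vec_trmx BT.
  rewrite -mulr2n -[vec B *+ 2]scaler_nat scalerA mulVf ?pnatr_eq0 // scale1r.
  by rewrite mulmxBl mul1mx tensmx_vec trmx_proj_perp.
have ET : E^T = E by rewrite linearB /= trmx_mul trmxK (trmx_economy ME).
have FT : F^T = F by rewrite linearB /= trmx_mul trmxK (trmx_economy ME).
have FL : vec F = L *m vec E + vec (gd_remainder E).
  rewrite FE vecD vecD vecN vecZ; congr (_ + _).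
  rewrite mulmxBl mul1mx -scalemxAl -mulmxA selection_mx_vec //.
  by rewrite (kronecker_sum_vec ME).
(* The three summands of [c] bound these three errors in order. *)
have -> : vec F - H_mx M U Omega eta *m vec E =
    P *m L *m vec (Pp *m E *m Pp) + P *m vec (gd_remainder E)
    + vec (Pp *m F *m Pp).
  have PF : P *m vec F = P *m L *m vec E + P *m vec (gd_remainder E).
    by rewrite FL mulmxDr mulmxA.
  have -> : vec F = P *m vec F + vec (Pp *m F *m Pp) by rewrite P_vec // subrK.
  rewrite PF /H_mx -/L -(mulmxA (P *m L)) (P_vec E) // [P *m L *m (_ - _)]mulmxBr.
  by rewrite opprB addrC !addrA subrK.
apply: le_trans (l1normD _ _) _; rewrite /c !mulrDl l1norm_vec lerD //.
apply: le_trans (l1normD _ _) _; rewrite lerD //.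
  apply: le_trans (l1normM _ _) _; rewrite -mulrA ler_wpM2l ?l1norm_ge0 //.
  by rewrite l1norm_vec.
apply: le_trans (l1normM _ _) _; rewrite -mulrA ler_wpM2l ?l1norm_ge0 //.
by rewrite l1norm_vec.
Qed.

(** Allowing any [q] above the spectral radius covers both a positive radius, with equality, and
    radius 0. *)
Lemma locally_converges_above_spectral_radius (q : R) :
  spectral_radius (H_mx M U Omega eta) <= q -> 0 < q < 1 ->
  locally_converges_at_rate r M Omega eta q.
Proof.
move=> rho_le q01; have /andP[q_gt0 _] := q01.
have [k [Z [Z_free ZE]]] := kronecker_sum_gram ME.
have := H_mx_symmetrizable Omega eta ME; rewrite ZE => HZ.
have [N [a [b [a_gt0 b_gt0 ND NH NE]]]] := adapted_norm Z_free HZ.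
have [c [d [c_gt0 d_gt0 step]]] := gd_step_linearization.
have N_ge0 x : 0 <= N x.
  have [_] := NE x; rewrite -(pmulr_rge0 _ a_gt0); exact: le_trans (l1norm_ge0 x).
(* The recursion is run on [N (vec E_j)]: the error [c |E|^2] is at most [c a^2 N^2], and measuring
   it with [N] costs [b]. The threshold [d / a] ensures [|E| <= d]. *)
have [e e_gt0 decay] := @quadratic_perturbation_decay R q (b * (c * a ^+ 2)) (d / a)
  q01 (mulr_gt0 b_gt0 (mulr_gt0 c_gt0 (exprn_gt0 2 a_gt0))) (divr_gt0 d_gt0 a_gt0).
(* The factors [a] and [b] convert between [N] and the l1 norm, 2 comes from the decay, and [n * n]
   from l1 to Frobenius, with a successor to keep the constant positive. *)
exists [set B | l1norm (B - M) <= e / b], (a * 2 * b * (n * n).+1%:R); split.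
- by apply: nbhs_l1norm_ball; apply: divr_gt0.
- by rewrite !mulr_gt0.
move=> X0 /=; rewrite ler_pdivlMr // => X0e k'.
pose E j := gd_iter M Omega eta X0 j *m (gd_iter M Omega eta X0 j)^T - M.
have ak : N (vec (E k')) <= 2 * N (vec (E 0%N)) * q ^+ k'.
  apply: (decay (fun j => N (vec (E j)))) => [j||j ajd]; first exact: N_ge0.
    by have [/le_trans -> //] := NE (vec (E 0%N)); rewrite l1norm_vec mulrC.
  have Ejd : l1norm (E j) <= d.
    have [_] := NE (vec (E j)); rewrite l1norm_vec => /le_trans -> //.
    by rewrite mulrC -ler_pdivlMr.
  rewrite -[vec (E j.+1)](subrK (H_mx M U Omega eta *m vec (E j))) addrC.
  apply: le_trans (ND _ _) _; apply: lerD.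
    by apply: le_trans (NH _) _; rewrite ler_wpM2r.
  have [/le_trans -> //] := NE (vec (E j.+1) - H_mx M U Omega eta *m vec (E j)).
  rewrite -mulrA ler_pM2l //.
  apply: le_trans (step (gd_iter M Omega eta X0 j) Ejd) _.
  rewrite -mulrA ler_pM2l // -exprMn.
  rewrite lerXn2r ?nnegrE ?l1norm_ge0 ?mulr_ge0 ?(ltW a_gt0) //.
  by have [_] := NE (vec (E j)); rewrite l1norm_vec.
apply: le_trans (frobenius_norm_le_l1norm _) _; rewrite -l1norm_vec.
have [_ /le_trans -> //] := NE (vec (E k')).
rewrite -/(E 0%N).
have -> : a * 2 * b * (n * n).+1%:R * frobenius_norm (E 0%N) * q ^+ k' =
  a * (2 * (b * ((n * n).+1%:R * frobenius_norm (E 0%N))) * q ^+ k') by ring.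
rewrite ler_pM2l //; apply: le_trans ak _.
rewrite ler_wpM2r ?exprn_ge0 ?(ltW q_gt0) // ler_pM2l //.
have [/le_trans -> //] := NE (vec (E 0%N)).
rewrite ler_pM2l // l1norm_vec; apply: le_trans (l1norm_le_frobenius_norm _) _.
by rewrite ler_wpM2r ?sqrtr_ge0 // ler_nat.
Qed.

End Dynamics.

(* The bound with rate rho(H) ^ k is the first conjunct.  When rho(H) = 0 that
   bound would say that one step lands exactly on M, which is false already
   for n = r = 1, M = 1, Omega full, eta = 1/2 (then H = 0, but
   x1^2 - 1 = e^2 (e - 3) / 4 where e = x0^2 - 1); "linear rate 0" is then
   read as: linear convergence at every rate q > 0. *)
Theorem theorem1 (R : realType) (n r : nat)
    (M : 'M[R]_n) (U : 'M[R]_(n, r)) (lam : 'rV[R]_r)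
    (Omega : {set 'I_n * 'I_n}) (eta : R) :
  (1 <= r <= n)%N ->
  M^T = M ->
  psd M ->
  \rank M = r ->
  economy_eigendecomposition M U lam ->
  symmetric_set Omega ->
  0 < eta ->
  spectral_radius (H_mx M U Omega eta) < 1 ->
  (0 < spectral_radius (H_mx M U Omega eta) ->
     locally_converges_at_rate r M Omega eta
       (spectral_radius (H_mx M U Omega eta)))
  /\
  (spectral_radius (H_mx M U Omega eta) = 0 ->
     forall q : R, 0 < q -> locally_converges_at_rate r M Omega eta q).
Proof.
move=> _ _ _ _ ME Os eta_gt0 rho_lt1; split=> [rho_gt0 | rho0 q q_gt0].
  apply: (locally_converges_above_spectral_radius ME Os eta_gt0) => //.
  by rewrite rho_gt0.
(* The rate must lie below 1; capping [q] at 1/2 achieves this, and the bound at the smaller rate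
   implies the one at [q]. *)
have m_gt0 : 0 < Num.min q 2^-1 by rewrite lt_min q_gt0 invr_gt0 ltr0n.
have [||N [C [N_nbhs C_gt0 conv]]] :=
  @locally_converges_above_spectral_radius _ _ _ _ _ _ _ _ ME Os eta_gt0
    (Num.min q 2^-1).
- by rewrite rho0 ltW.
- by rewrite m_gt0 gt_min invf_lt1 ?ltr0n // ltr1n orbT.
exists N, C; split=> // X0 NX0 k; apply: le_trans (conv X0 NX0 k) _.
rewrite ler_wpM2l ?mulr_ge0 ?sqrtr_ge0 ?(ltW C_gt0) //.
by rewrite lerXn2r ?nnegrE ?(ltW m_gt0) ?(ltW q_gt0) // ge_min lexx.
Qed.
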